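(* Let $T$ be a $4$-ball tetrahedron such that the center of its mid-sphere lies in the interior of $T$. Then $T$ can be partitioned face-to-face into $24$ path tetrahedra.
   Context: A tetrahedron is the convex hull of four points in $\mathbb{R}^3$ not lying in the same plane. A tetrahedron $T$ is called a $4$-ball tetrahedron if there exists a sphere tangent to all six edges of $T$, where the edges are the closed line segments joining pairs of vertices (so the sphere touches each edge segment); this sphere is called the mid-sphere of $T$. A tetrahedron is called a path tetrahedron if it has three mutually orthogonal edges that do not intersect at a single point. A partition of $T$ into tetrahedra (a finite set of tetrahedra with pairwise disjoint interiors whose union is $T$) is face-to-face if the intersection of any two distinct tetrahedra in it is either empty, or a common vertex, or a common edge, or a common face of both. *)

(* Defs.v *)
From HB Require Import structures.
From mathcomp Require Import all_boot all_order all_algebra.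
From mathcomp Require Import all_classical all_reals all_analysis.

Set Implicit Arguments.
Unset Strict Implicit.
Unset Printing Implicit Defensive.

Import Order.TTheory GRing.Theory Num.Theory.
Import numFieldNormedType.Exports.

Local Open Scope classical_set_scope.
Local Open Scope ring_scope.

(* The library norm on ['rV[R]_3] is the sup norm, so Euclidean geometry goes
   through [dot]; the topology (used for interiors) is the usual one. *)
Notation E3 R := 'rV[R]_3.

Section Geometry.
Variable R : realType.
Implicit Types (u v a b c : E3 R) (r : R).

Definition dot u v : R := \sum_(i < 3) u 0 i * v 0 i.

Definition sphere c r : set (E3 R) :=
  [set x | dot (x - c) (x - c) = r ^+ 2].

Definition plane u (d : R) : set (E3 R) := [set x | dot u x = d].

Definition coplanar (X : set (E3 R)) : Prop :=
  exists u d, u != 0 /\ X `<=` plane u d.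

Definition convex_hull (X : set (E3 R)) : set (E3 R) :=
  smallest (@convex_set R (E3 R)) X.

(* Four labelled points; all notions below are invariant under relabelling. *)
Record tetrahedron := Tetrahedron {
  vertex : 'I_4 -> E3 R;
  vertex_noncoplanar : ~ coplanar (range vertex) }.

Implicit Types T : tetrahedron.

Definition body T : set (E3 R) := convex_hull (range (vertex T)).

(* The vertices, edges and triangular faces are the cases #|S| = 1, 2, 3. *)
Definition face T (S : {set 'I_4}) : set (E3 R) :=
  convex_hull (vertex T @` [set` S]).

(* For e.1 != e.2, the closed segment joining two vertices, and its direction. *)
Definition edge T (e : 'I_4 * 'I_4) : set (E3 R) := face T [set e.1; e.2].
Definition edge_vec T (e : 'I_4 * 'I_4) : E3 R :=
  vertex T e.2 - vertex T e.1.

(* The tangency point x must lie on the closed edge itself, and the edge must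
   lie in the tangent plane of the sphere at x, i.e. be orthogonal to the
   radius x - c. *)
Definition sphere_tangent_edge c r T (e : 'I_4 * 'I_4) : Prop :=
  exists x, [/\ edge T e x, sphere c r x & dot (x - c) (edge_vec T e) = 0].

Definition mid_sphere T c r : Prop :=
  0 < r /\ forall e, e.1 != e.2 -> sphere_tangent_edge c r T e.

Definition path_tetrahedron T : Prop :=
  exists e : 'I_3 -> 'I_4 * 'I_4,
    [/\ forall k, (e k).1 != (e k).2,
        forall k l, k != l -> dot (edge_vec T (e k)) (edge_vec T (e l)) = 0
      & \bigcap_k edge T (e k) = set0].

(* Bodies have nonempty interior, so distinct indices give distinct bodies:
   the family P is a set of exactly n tetrahedra. *)
Definition partition_into (n : nat) T (P : 'I_n -> tetrahedron) : Prop :=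
  (forall i j, i != j ->
     interior (body (P i)) `&` interior (body (P j)) = set0) /\
  \bigcup_i body (P i) = body T.

Definition face_to_face (n : nat) (P : 'I_n -> tetrahedron) : Prop :=
  forall i j, i != j ->
    body (P i) `&` body (P j) = set0 \/
    exists S S' : {set 'I_4},
      [/\ (1 <= #|S| <= 3)%N, #|S'| = #|S|,
          body (P i) `&` body (P j) = face (P i) S
        & body (P i) `&` body (P j) = face (P j) S'].

End Geometry.

(* Main.v *)
Require Import Defs.
From HB Require Import structures.
From mathcomp Require Import all_boot all_order all_algebra all_fingroup.
From mathcomp Require Import all_classical all_reals all_analysis.
From mathcomp Require Import ring lra.

Set Implicit Arguments.
Unset Strict Implicit.
Unset Printing Implicit Defensive.

Import Order.TTheory GRing.Theory Num.Theory.
Import numFieldNormedType.Exports.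

Local Open Scope classical_set_scope.
Local Open Scope ring_scope.

(** The points of [T] of interest are feet of perpendiculars. For a nonempty
    set [S] of vertices let [b_S] be the orthogonal projection of the centre
    [c] onto the affine hull of [S]: a vertex, the tangency point on an edge,
    the incentre of a triangular face, and [c] itself when [S] is
    everything. If every [b_S] lies in the relative interior of the face [S],
    then the tetrahedra spanned by [b_{S1}, b_{S2}, b_{S3}, b_{S4}], for the 24
    flags [S1 < S2 < S3 < S4] of vertex sets, subdivide [T] exactly as the
    barycentric subdivision does. Each of them is a path tetrahedron along
    [b_{S1} b_{S2} b_{S3} b_{S4}]: the step from [b_{Sl}] to [b_{Sl+1}] is
    orthogonal to the hull of [Sl], which contains all the earlier steps.

    Positivity is where the mid-sphere enters. Writing [t_i] for the length of
    the tangents from the vertex [A_i], tangency forces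
    [(A_i - c).(A_j - c) = r^2 - t_i t_j] for [i <> j], and [r^2 + t_i^2] for
    [i = j] (tangent_gram). From this Gram matrix the barycentric coordinates
    of [b_S], for an edge or a face, come out proportional to
    [(sum over S of t) - t_i]: on an edge this is the other tangent length, on a
    face the length of the opposite side, so that [b_S] is the incentre. All
    [t_i] are positive because the edges at a vertex lying on the sphere would
    all lie in the tangent plane there. For the full vertex set, positivity of
    the coordinates is the hypothesis that [c] is interior.

    The subdivision itself is combinatorial and holds for any weights [w S]
    that are positive exactly on [S]. Every nonnegative vector is a nonnegative
    combination of the [w S] along a flag, and two such combinations of the same
    vector agree, with every set actually used belonging to both flags
    (flag_comb_surj, flag_comb_inj). Existence gives the covering of [T];
    uniqueness gives that two cells meet exactly in the face spanned by the
    vertices they share, hence that their interiors are disjoint. *)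

(** * Flags of vertex sets *)

(** A flag of subsets of ['I_n] is encoded by a permutation, its [m]-element
    member being the image of the first [m] indices. *)
Definition prefix_set n (s : {perm 'I_n}) (m : nat) : {set 'I_n} :=
  [set i | (s^-1%g i < m)%N]%SET.

Lemma mem_prefix_set n (s : {perm 'I_n}) m k :
  (s k \in prefix_set s m) = (k < m)%N.
Proof. by rewrite inE permK. Qed.

Lemma card_prefix_set n (s : {perm 'I_n}) m :
  #|prefix_set s m| = #|[set j : 'I_n | (j < m)%N]%SET|.
Proof.
rewrite -[RHS](card_preimset _ (@perm_inj _ s^-1%g)).
apply: eq_card => i.
by rewrite !inE.
Qed.

Lemma prefix_set_full n (s : {perm 'I_n}) : prefix_set s n = [set: 'I_n]%SET.
Proof. by apply/setP => i; rewrite !inE ltn_ord. Qed.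

Lemma prefix_set_mono n (s : {perm 'I_n}) l m :
  (l <= m)%N -> prefix_set s l \subset prefix_set s m.
Proof. by move=> lm; apply/fintype.subsetP => i; rewrite !inE => /leq_trans; apply. Qed.

Lemma prefix_set_inj n (s t : {perm 'I_n}) :
  (forall k : 'I_n, prefix_set s k.+1 = prefix_set t k.+1) -> s = t.
Proof.
move=> st; apply/permP => k.
have : s k \in prefix_set t k.+1 by rewrite -st mem_prefix_set.
rewrite inE ltnS leq_eqVlt => /orP[/eqP/val_inj/(congr1 t)|lt_k].
  by rewrite permKV.
have : s k \in prefix_set t (t^-1%g (s k)).+1 by rewrite inE.
by rewrite -st mem_prefix_set ltnS leqNgt lt_k.
Qed.

(** * Expansion of nonnegative vectors along flags *)

Section weights.
Variables (R : realFieldType) (n : nat) (w : {set 'I_n} -> 'I_n -> R).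
Hypothesis w_out : forall (S : {set 'I_n}) i, i \notin S -> w S i = 0.
Hypothesis w_gt0 : forall (S : {set 'I_n}) i, i \in S -> 0 < w S i.

Let w_ge0 S i : 0 <= w S i.
Proof. by have [/w_gt0/ltW//|/w_out->] := boolP (i \in S). Qed.

Let trunc_comb s (mu : 'I_n -> R) (k : 'I_n) i :=
  \sum_(l : 'I_n | (l <= k)%N) mu l * w (prefix_set s l.+1) i.

(** A nonnegative sum truncated at [k] with a nonzero top coefficient has support
    exactly the top set, so equal sums force inclusion, hence equality, of sets of the
    same size. *)
Let top_set_determined s t (mu nu : 'I_n -> R) (k : 'I_n) :
    (forall l, 0 <= mu l) -> (forall i, trunc_comb s mu k i = trunc_comb t nu k i) ->
  mu k != 0 -> prefix_set s k.+1 = prefix_set t k.+1.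
Proof.
move=> mu0 E muk; apply/eqP; rewrite eqEcard !card_prefix_set leqnn andbT.
apply/fintype.subsetP => i ik; apply: contraT => it.
have: 0 < trunc_comb s mu k i.
  rewrite /trunc_comb (bigD1 k) //= ltr_wpDr //.
    by rewrite sumr_ge0 // => l _; rewrite mulr_ge0.
  by rewrite mulr_gt0 // ?w_gt0 // lt_neqAle eq_sym muk mu0.
rewrite E /trunc_comb big1 ?ltxx // => l lk; rewrite w_out ?mulr0 //.
by apply: contra it; apply/fintype.subsetP; exact: prefix_set_mono.
Qed.

(** At the last element [s k] of the common top set, the left-hand side sees
    only its top term. *)
Let top_coef_le s t (mu nu : 'I_n -> R) (k : 'I_n) :
    (forall l, 0 <= nu l) -> (forall i, trunc_comb s mu k i = trunc_comb t nu k i) ->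
  prefix_set s k.+1 = prefix_set t k.+1 -> nu k <= mu k.
Proof.
move=> nu0 /(_ (s k)) E st.
have sk : s k \in prefix_set s k.+1 by rewrite mem_prefix_set.
move: E; rewrite /trunc_comb (bigD1 k) //= [in RHS](bigD1 k) //= -st.
rewrite big1 => [|l /andP[lk nlk]]; last first.
  by rewrite w_out ?mulr0 // mem_prefix_set ltnS -ltnNge ltn_neqAle lk andbT.
rewrite addr0 => E; rewrite -(ler_pM2r (w_gt0 sk)) E lerDl.
by rewrite sumr_ge0 // => l _; rewrite mulr_ge0.
Qed.

(** The terms are identified from the largest set downwards: once those above
    rank [k] agree they cancel, and the supports of the truncated sums then
    determine the term of rank [k]. *)
Lemma flag_comb_inj s t (mu nu : 'I_n -> R) :
    (forall k, 0 <= mu k) -> (forall k, 0 <= nu k) ->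
    (forall i, \sum_k mu k * w (prefix_set s k.+1) i =
               \sum_k nu k * w (prefix_set t k.+1) i) ->
  forall k, mu k = nu k /\
    (mu k != 0 -> prefix_set s k.+1 = prefix_set t k.+1).
Proof.
move=> mu0 nu0 E k.
have [d] := ubnP (n - k); elim: d k => // d IH k; rewrite ltnS => kd.
have {}E i : trunc_comb s mu k i = trunc_comb t nu k i.
  move: (E i); rewrite (bigID (fun l : 'I_n => (l <= k)%N)) /=.
  rewrite [in RHS](bigID (fun l : 'I_n => (l <= k)%N)) /=.
  suff -> : \sum_(l : 'I_n | ~~ (l <= k)%N) mu l * w (prefix_set s l.+1) i =
            \sum_(l : 'I_n | ~~ (l <= k)%N) nu l * w (prefix_set t l.+1) i by move/addIr.
  apply: eq_bigr => l; rewrite -ltnNge => kl.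
  have [|<- mul] := IH l; first by rewrite (leq_trans _ kd) // ltn_sub2l.
  by have [->|/mul->] := eqVneq (mu l) 0; rewrite ?mul0r.
have Es i := esym (E i).
have [st|/eqP st] := eqVneq (prefix_set s k.+1) (prefix_set t k.+1).
  by split=> //; apply/eqP; rewrite eq_le (top_coef_le mu0 Es) ?(top_coef_le nu0 E).
have -> : mu k = 0.
  by apply/eqP; apply: contra_notT st; apply: top_set_determined.
have -> : nu k = 0; last by rewrite eqxx.
by apply/eqP; apply: contra_notT st => H; rewrite (top_set_determined nu0 Es).
Qed.

(** Peel off the sets from the largest downwards: subtract from [x] the largest
    multiple of [w S] that leaves it nonnegative. This kills a coordinate [i]
    minimizing [x i / w S i], which is then made the last element of [S] in the
    order being built. *)
Lemma flag_comb_surj (x : 'I_n -> R) : (forall i, 0 <= x i) ->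
  exists s (mu : 'I_n -> R), (forall k, 0 <= mu k) /\
    forall i, x i = \sum_k mu k * w (prefix_set s k.+1) i.
Proof.
move=> x0.
(* [y] is the remainder, supported on the first [n - d] indices, once the [d]
   largest sets have been subtracted. *)
suff : forall d, (d <= n)%N -> exists s (y mu : 'I_n -> R),
    [/\ forall i, 0 <= y i, forall i, i \notin prefix_set s (n - d) -> y i = 0,
        forall k, 0 <= mu k
      & forall i, x i = y i +
          \sum_(k : 'I_n | (n - d <= k)%N) mu k * w (prefix_set s k.+1) i].
  case/(_ n (leqnn n)) => s [y [mu [_ yS mu0 xE]]]; exists s, mu; split=> // i.
  rewrite xE yS; last by rewrite subnn inE.
  by rewrite add0r; apply: eq_bigl => k; rewrite subnn.
elim=> [|d IH] dn.
  exists 1%g, x, (fun=> 0); split=> // i; first by rewrite subn0 prefix_set_full inE.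
  by rewrite big1 ?addr0 // => k _; rewrite mul0r.
have [s [y [mu [y0 yS mu0 xE]]]] := IH (ltnW dn).
set m := (n - d.+1)%N.
have Em : (n - d)%N = m.+1 by rewrite /m subnS prednK // subn_gt0.
have mn : (m < n)%N by rewrite -Em leq_subr.
rewrite Em in yS xE.
pose o := Ordinal mn; pose S := prefix_set s m.+1.
have so : s o \in S by rewrite mem_prefix_set.
case: (arg_minP (fun i => y i / w S i) so) => i iS imin.
pose rho := y i / w S i.
(* Exchanging [i] with the last element of [S] leaves all larger sets alone. *)
pose s' := (tperm (s^-1%g i) o * s)%g.
have s'V j : s'^-1%g j = tperm (s^-1%g i) o (s^-1%g j).
  by rewrite /s' invMg permM tpermV.
have {}iS : i \in S := iS.
have im : (s^-1%g i <= m)%N by move: iS; rewrite inE.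
have s'S k : (m <= k)%N -> prefix_set s' k.+1 = prefix_set s k.+1.
  move=> mk; apply/setP => j; rewrite !inE s'V !ltnS.
  case: tpermP => [->|->|//] /=; by rewrite mk (leq_trans im).
exists s', (fun j => y j - rho * w S j), (fun k => if k == o then rho else mu k).
split=> [j|j|k|j].
- have [jS|jS] := boolP (j \in S); last by rewrite (w_out jS) mulr0 subr0.
  by rewrite subr_ge0 -ler_pdivlMr ?w_gt0 // imin.
- rewrite inE -leqNgt leq_eqVlt => /orP[/eqP mj|mj]; last first.
    have jS : j \notin S by rewrite /S -s'S // inE ltnS -ltnNge.
    by rewrite yS // w_out // mulr0 subr0.
  have /(congr1 s') : s'^-1%g j = o by apply: val_inj.
  rewrite permKV /s' permM tpermR permKV => ->.
  by rewrite divfK ?subrr // gt_eqF // w_gt0.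
- by case: ifP => // _; rewrite divr_ge0.
- rewrite xE (bigD1 o (P := fun k : 'I_n => (m <= k)%N)) ?leqnn //= eqxx.
  rewrite s'S // addrA subrK; congr (_ + _); apply: eq_big => k.
    by rewrite ltn_neqAle andbC eq_sym.
  by move=> mk; rewrite s'S ?(ltnW mk) // ifN //; apply: contraL mk => /eqP->; rewrite ltnn.
Qed.

End weights.

(** * Convex hulls *)

Lemma convex_setP (R : realType) (A : set (E3 R)) :
  @convex_set R (E3 R) A <-> forall x y (p : R), 0 <= p -> p <= 1 ->
    A x -> A y -> A (p *: x + (1 - p) *: y).
Proof.
split=> [cA x y p p0 p1 /mem_set Ax /mem_set Ay|cA x y l /set_mem Ax /set_mem Ay].
  exact: set_mem (cA _ _ (Itv01 p0 p1) Ax Ay).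
by apply/mem_set; apply: cA.
Qed.

Section hull.
Variables (R : realType) (I : finType).
Implicit Types (v : I -> E3 R) (mu : I -> R).

(** Normalizing by the total weight, which need not be 1, makes the statement
    stable under removing a term, so that it can be proved by induction on [r]. *)
Lemma convex_set_comb v (A : set (E3 R)) mu (r : seq I) :
    @convex_set R (E3 R) A -> (forall i, 0 <= mu i) ->
    (forall i, mu i != 0 -> A (v i)) ->
    0 < \sum_(i <- r) mu i ->
  A ((\sum_(i <- r) mu i)^-1 *: \sum_(i <- r) mu i *: v i).
Proof.
move=> cA mu0 Av; elim: r => [|i r IH]; first by rewrite big_nil ltxx.
rewrite !big_cons; set a := \sum_(j <- r) mu j; set y := \sum_(j <- r) _ => ia.
have a0 : 0 <= a by rewrite sumr_ge0.
have [mui|mui] := eqVneq (mu i) 0.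
  by move: ia; rewrite mui scale0r !add0r => /IH.
have [az|an] := eqVneq a 0.
  have -> : y = 0.
    apply: big1_seq => j /= jr.
    suff -> : mu j = 0 by rewrite scale0r.
    move/eqP: az; rewrite psumr_eq0 // => /allP/(_ _ jr)/implyP/(_ isT)/eqP//.
  by rewrite az !addr0 scalerA mulVf // scale1r; exact: Av.
have ap : 0 < a by rewrite lt_neqAle eq_sym an.
have i0 : 0 <= (mu i + a)^-1 * mu i by rewrite mulr_ge0 // invr_ge0 ltW.
have i1 : (mu i + a)^-1 * mu i <= 1.
  by rewrite mulrC ler_pdivrMr // mul1r lerDl.
move/convex_setP: cA => /(_ _ _ _ i0 i1 (Av _ mui) (IH ap)).
congr A; rewrite scalerDr !scalerA; congr (_ + _ *: _).
by rewrite -/a; field; rewrite an gt_eqF.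
Qed.

Lemma convex_hullE v (S : {set I}) :
  convex_hull (v @` [set` S]) =
  [set x | exists mu, [/\ forall i, 0 <= mu i, forall i, i \notin S -> mu i = 0,
    \sum_i mu i = 1 & x = \sum_i mu i *: v i]].
Proof.
apply/seteqP; split.
  apply: smallest_sub => [|_ [i iS <-]].
    apply/convex_setP => x y p p0 p1 [mu [mu0 muS mu1 ->]] [nu [nu0 nuS nu1 ->]].
    exists (fun i => p * mu i + (1 - p) * nu i); split.
    - by move=> i; rewrite addr_ge0 // mulr_ge0 // subr_ge0.
    - by move=> i iS; rewrite muS // nuS // !mulr0 addr0.
    - by rewrite big_split /= -!mulr_sumr mu1 nu1 !mulr1 addrC subrK.
    - rewrite !scaler_sumr -big_split /=; apply: eq_bigr => i _.
      by rewrite [RHS]scalerDl !scalerA.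
  exists (fun j => (j == i)%:R); split.
  - by move=> j; rewrite ler0n.
  - by move=> j jS; case: eqP jS => // ->; rewrite iS.
  - by rewrite (bigD1 i) //= eqxx big1 ?addr0 // => j /negbTE->.
  - by rewrite (bigD1 i) //= eqxx scale1r big1 ?addr0 // => j /negbTE->; rewrite scale0r.
move=> _ [mu [mu0 muS mu1 ->]] A [cA vA].
have := @convex_set_comb v A mu (index_enum I) cA mu0 _ _.
rewrite mu1 invr1 scale1r; apply=> // i mui; apply: vA; exists i => //=.
by apply: contraNT mui => /muS->.
Qed.

End hull.

(** * The scalar product *)

Section dot.
Variable R : realType.
Implicit Types u v x : E3 R.

Lemma dotC u v : dot u v = dot v u.
Proof. by apply: eq_bigr => i _; rewrite mulrC. Qed.

Lemma dotDr u v x : dot u (v + x) = dot u v + dot u x.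
Proof. by rewrite -big_split; apply: eq_bigr => i _; rewrite mxE mulrDr. Qed.

Lemma dotZr a u v : dot u (a *: v) = a * dot u v.
Proof. by rewrite mulr_sumr; apply: eq_bigr => i _; rewrite mxE mulrCA. Qed.

Lemma dotBr u v x : dot u (v - x) = dot u v - dot u x.
Proof. by rewrite dotDr -scaleN1r dotZr mulN1r. Qed.

Lemma dotDl u v x : dot (v + x) u = dot v u + dot x u.
Proof. by rewrite dotC dotDr !(dotC u). Qed.

Lemma dotZl a u v : dot (a *: v) u = a * dot v u.
Proof. by rewrite dotC dotZr dotC. Qed.

Lemma dotBl u v x : dot (v - x) u = dot v u - dot x u.
Proof. by rewrite dotC dotBr !(dotC u). Qed.

Lemma dot0l u : dot 0 u = 0.
Proof. by rewrite -[0](scale0r 0) dotZl mul0r. Qed.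

Lemma dot_sumr (I : Type) (r : seq I) u (a : I -> R) (v : I -> E3 R) :
  dot u (\sum_(i <- r) a i *: v i) = \sum_(i <- r) a i * dot u (v i).
Proof.
elim: r => [|i r IH]; first by rewrite !big_nil dotC dot0l.
by rewrite !big_cons dotDr dotZr IH.
Qed.

Lemma dot_suml (I : Type) (r : seq I) u (a : I -> R) (v : I -> E3 R) :
  dot (\sum_(i <- r) a i *: v i) u = \sum_(i <- r) a i * dot (v i) u.
Proof. by rewrite dotC dot_sumr; apply: eq_bigr => i _; rewrite dotC. Qed.

Lemma dot_self_ge0 u : 0 <= dot u u.
Proof. by apply: sumr_ge0 => i _; exact: sqr_ge0. Qed.

End dot.

(** * Barycentric coordinates in a tetrahedron *)

Section tetra.
Variable R : realType.
Implicit Types T : tetrahedron R.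

Lemma faceE T (S : {set 'I_4}) : face T S =
  [set x | exists mu : 'I_4 -> R, [/\ forall i, 0 <= mu i,
    forall i, i \notin S -> mu i = 0,
    \sum_i mu i = 1 & x = \sum_i mu i *: vertex T i]].
Proof. exact: convex_hullE. Qed.

Lemma bodyE T : body T = face T [set: 'I_4]%SET.
Proof.
rewrite /body /face; congr convex_hull; apply/seteqP; split=> [_ [i _ <-]|_ [i _ <-]].
  by exists i => //=; rewrite inE.
by exists i.
Qed.

(** An affine dependence is a left kernel vector of the square matrix with rows
    [(A_k, 1)]; a right kernel vector [(u, d)] of the same matrix is a plane
    containing all the vertices. *)
Lemma vertex_affine_independent T (a : 'I_4 -> R) :
  \sum_i a i = 0 -> \sum_i a i *: vertex T i = 0 -> forall i, a i = 0.
Proof.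
move=> a0 av i; apply/eqP; apply: contraT => ai.
have [] := vertex_noncoplanar (t := T).
pose M : 'M[R]_4 := \matrix_(k, j) row_mx (vertex T k) (1%:M : 'M[R]_1) 0 j.
have ME k : (forall l : 'I_3, M k (@lshift 3 1 l) = vertex T k 0 l) *
            (forall l : 'I_1, M k (@rshift 3 1 l) = 1).
  by split=> l; rewrite mxE ?(@row_mxEl _ 1 3 1) // (@row_mxEr _ 1 3 1) ord1 mxE.
have /eqP : \det M = 0.
  apply/eqP/det0P; exists (\row_k a k).
    by apply: contra ai => /eqP/rowP/(_ i); rewrite !mxE => ->.
  apply/rowP => j; rewrite mxE [RHS]mxE; under eq_bigr do rewrite mxE.
  case: (@split_ordP 3 1 j) => l ->.
    under eq_bigr do rewrite ME.
    move/rowP: av => /(_ l); rewrite summxE [RHS]mxE => {2}<-.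
    by apply: eq_bigr => k _; rewrite mxE.
  under eq_bigr do rewrite ME mulr1.
  exact: a0.
rewrite -det_tr => /eqP; move/eqP/det0P => [u u0 uM].
pose x : 'rV[R]_3 := @lsubmx _ 1 3 1 u; pose d := @rsubmx _ 1 3 1 u 0 0.
have E k : dot x (vertex T k) + d = 0.
  move/rowP: uM => /(_ k); rewrite mxE [RHS]mxE (@big_split_ord _ _ _ 3 1) /=.
  rewrite big_ord1 mxE ME mulr1 => <-; rewrite /d mxE; congr (_ + _).
  by apply: eq_bigr => l _; rewrite 2!mxE ME.
exists x, (- d); split; last first.
  by move=> _ [k _ <-]; apply/eqP; rewrite -addr_eq0 E.
apply: contra u0 => /eqP x0.
have d0 : d = 0 by have := E 0; rewrite x0 dot0l add0r.
apply/eqP; rewrite -[u](@hsubmxK _ 1 3 1) -/x x0.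
suff -> : @rsubmx _ 1 3 1 u = 0 by rewrite row_mx0.
by apply/rowP => l; rewrite (ord1 l) [RHS]mxE; exact: d0.
Qed.

Lemma barycentric_inj T (a b : 'I_4 -> R) :
  \sum_i a i = \sum_i b i ->
  \sum_i a i *: vertex T i = \sum_i b i *: vertex T i -> a =1 b.
Proof.
move=> ab E i; apply/eqP; rewrite -subr_eq0; apply/eqP.
apply: (vertex_affine_independent (T := T) (a := fun i => a i - b i)).
  by rewrite sumrB ab subrr.
by under eq_bigr do rewrite scalerBl; rewrite sumrB E subrr.
Qed.

(** From an interior point one can move by a small multiple [e] of its
    difference with the vertex [i] and stay in the body; the [i]-th coordinate
    [(1 + e) * a i - e] of the new point is then still nonnegative. *)
Lemma interior_barycentric_gt0 T (a : 'I_4 -> R) :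
  \sum_i a i = 1 -> interior (body T) (\sum_i a i *: vertex T i) ->
  forall i, 0 < a i.
Proof.
move=> a1; set x := \sum_i _ => xT i.
have : (fun e : R => x + e *: (x - vertex T i)) @ (0 : R) --> x.
  have := @cvgD _ _ _ (nbhs (0 : R)) _ _ _ _ _ (cvg_cst x)
    (@scalel_continuous R _ (x - vertex T i) 0).
  by rewrite scale0r addr0; apply.
move=> /(_ _ xT)[d /= d0]; set e := d / 2.
have e0 : 0 < e by rewrite divr_gt0.
move=> /(_ e); rewrite /ball /= sub0r normrN gtr0_norm // ltr_pdivrMr //.
rewrite mulr2n mulrDr mulr1 ltrDl => /(_ d0).
rewrite bodyE faceE => -[mu [mu0 _ mu1 E]].
have := @barycentric_inj T mu (fun j => a j + e * (a j - (j == i)%:R)) _ _ i.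
rewrite eqxx /= => H.
have {}H : mu i = a i + e * (a i - 1).
  have s1 : \sum_(j < 4) ((j == i)%:R : R) = 1.
    by rewrite (bigD1 i) //= eqxx big1 ?addr0 // => j /negbTE->.
  apply: H; first by rewrite big_split /= -mulr_sumr sumrB mu1 a1 s1 subrr mulr0 addr0.
  rewrite -E; under eq_bigr do rewrite scalerDl -scalerA scalerBl.
  rewrite big_split /= -scaler_sumr sumrB -/x; congr (_ + _ *: (_ - _)).
  rewrite (bigD1 i) //= eqxx scale1r big1 ?addr0 // => j /negbTE->.
  by rewrite scale0r.
have := mu0 i; rewrite H => H0.
have : 0 < (1 + e) * a i by nra.
by rewrite pmulr_rgt0 // addr_gt0.
Qed.

End tetra.

(** * Barycentric coordinates of the feet of the perpendiculars *)

Section face_weights.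
Variables (R : realFieldType) (n : nat) (t lam : 'I_n -> R).
Hypotheses (t_gt0 : forall i, 0 < t i) (lam_gt0 : forall i, 0 < lam i).
Hypothesis lam1 : \sum_i lam i = 1.

(** With [t] the tangent lengths at the vertices of a tetrahedron, these are the
    barycentric coordinates of the projection of the centre of the mid-sphere:
    on a pair [{i, j}] the weight of [i] is [t j / (t i + t j)], on a triple it
    is the length of the side opposite to [i] divided by the perimeter. The general
    formula degenerates to 0/0 on singletons, and on the whole vertex set the
    coordinates [lam] of the centre are prescribed. *)
Definition face_weight (S : {set 'I_n}) (i : 'I_n) : R :=
  if i \notin S then 0
  else if #|S| == 1%N then 1
  else if S == [set: 'I_n]%SET then lam i
  else (\sum_(j in S) t j - t i) / ((#|S|.-1)%:R * \sum_(j in S) t j).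

Lemma face_weight_out (S : {set 'I_n}) i : i \notin S -> face_weight S i = 0.
Proof. by rewrite /face_weight => ->. Qed.

Let total_gt0 (S : {set 'I_n}) i : i \in S -> 0 < \sum_(j in S) t j.
Proof.
by move=> iS; rewrite (big_setD1 i) //= ltr_wpDr // sumr_ge0 // => j _; exact: ltW.
Qed.

Lemma face_weight_gt0 (S : {set 'I_n}) i : i \in S -> 0 < face_weight S i.
Proof.
move=> iS; rewrite /face_weight iS /=; case: ifP => // S1; case: ifP => // _.
have [j jS] : exists j, j \in S :\ i.
  by apply/set0Pn; rewrite -cards_eq0; move: S1; rewrite (cardsD1 i S) iS; case: #|_|.
have S1' : (0 < #|S|.-1)%N.
  by rewrite (cardsD1 i S) iS /= card_gt0; apply/set0Pn; exists j.
rewrite divr_gt0 // ?mulr_gt0 ?ltr0n ?(total_gt0 iS) //.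
by rewrite (big_setD1 i) //= addrAC subrr add0r (total_gt0 jS).
Qed.

Lemma sum_face_weight (S : {set 'I_n}) : S != finset.set0 ->
  \sum_i face_weight S i = 1.
Proof.
move=> /set0Pn[i0 i0S].
rewrite (bigID [in S]) /= [X in _ + X]big1 ?addr0 => [|i]; last exact: face_weight_out.
have [/cards1P[j ->]|S1] := boolP (#|S| == 1%N).
  by rewrite big_set1 /face_weight inE eqxx /= cards1.
have [->|ST] := eqVneq S [set: 'I_n]%SET.
  have [n1|n1] := eqVneq #|[set: 'I_n]%SET| 1%N.
    by case/eqP/cards1P: n1 => j ->; rewrite big_set1 /face_weight inE eqxx /= cards1.
  rewrite -[RHS]lam1 big_mkcond; apply: eq_bigr => i _.
  by rewrite /face_weight !inE /= (negbTE n1) eqxx.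
rewrite (eq_bigr (fun i => (\sum_(j in S) t j - t i) /
   ((#|S|.-1)%:R * \sum_(j in S) t j))); last first.
  by move=> i iS; rewrite /face_weight iS /= (negbTE S1) (negbTE ST).
rewrite -mulr_suml sumrB sumr_const -[X in _ *+ X](@prednK #|S|); last first.
  by apply/card_gt0P; exists i0.
rewrite mulrS addrAC subrr add0r mulr_natl divff // -mulr_natl mulf_neq0 //; last first.
  by rewrite gt_eqF // (total_gt0 i0S).
rewrite pnatr_eq0; move: S1; rewrite (cardsD1 i0 S) i0S.
by case: #|_|.
Qed.

(** Up to sign and the normalizing factor, the left-hand side is the part
    depending on [i] of the scalar product of [b_S - c] with [A_i - c] computed
    from the Gram matrix of the mid-sphere; its being constant on [S] says that
    [b_S - c] is orthogonal to the face [S]. *)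
Lemma face_weight_balance (S : {set 'I_n}) : (1 < #|S| <= 3)%N -> exists kappa,
  forall i, i \in S -> t i * (\sum_(k in S) (\sum_(j in S) t j - t k) * t k
     - 2 * (\sum_(j in S) t j - t i) * t i) = kappa.
Proof.
(* With [S = {i, a, b}] the expression collapses to [2 t_i t_a t_b], and on a
   pair to 0. *)
move=> S23; exists (if #|S| == 2%N then 0 else 2 * \prod_(j in S) t j) => i iS.
rewrite !(big_setD1 i iS) /=.
have [m Sm] : exists S', S' = (S :\ i)%SET by exists (S :\ i)%SET.
rewrite (cardsD1 i S) iS -Sm /= in S23 *; move: S23.
have [/cards1P[a ->] _|m1 S23] := boolP (#|m| == 1%N).
  by rewrite cards1 !big_set1; ring.
have /cards2P[a [b [ab ->]]] : #|m| == 2%N by move: m1 S23; case: #|m| => [|[|[|]]].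
by rewrite cards2 ab !big_setU1 ?inE //= !big_set1; ring.
Qed.

End face_weights.

(** * The Gram matrix of a mid-sphere *)

Section mid_sphere.
Variables (R : realType) (T : tetrahedron R) (c : E3 R) (r : R).
Hypothesis hmid : mid_sphere T c r.

(** By Pythagoras, the distance from a vertex to its tangency points. *)
Definition tangent_length (i : 'I_4) : R :=
  Num.sqrt (dot (vertex T i - c) (vertex T i - c) - r ^+ 2).

(** The parameter [p] of the tangency point along the edge, with both ends of
    the edge written as that point plus a multiple of the edge vector [d]. *)
Let tangent_point (i j : 'I_4) : i != j -> exists p : R,
  let d := vertex T j - vertex T i in
  [/\ 0 <= p <= 1,
      vertex T i - c = (vertex T i + p *: d - c) - p *: d,
      vertex T j - c = (vertex T i + p *: d - c) + (1 - p) *: d,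
      dot (vertex T i + p *: d - c) (vertex T i + p *: d - c) = r ^+ 2
    & dot (vertex T i + p *: d - c) d = 0].
Proof.
move=> ij; have [_ /(_ (i, j) ij)[x [/=]]] := hmid.
rewrite /edge faceE /= => -[mu [mu0 muS]].
rewrite (bigD1 i) //= (bigD1 j) 1?eq_sym //= big1 => [|k /andP[ki kj]]; last first.
  by rewrite muS // !inE negb_or ki.
rewrite addr0 => mu1.
rewrite (bigD1 i) //= (bigD1 j) 1?eq_sym //= big1 => [|k /andP[ki kj]]; last first.
  by rewrite muS ?scale0r // !inE negb_or ki.
have -> : mu i = 1 - mu j by rewrite -mu1 addrK.
rewrite addr0 => xE.
have {}xE : x = vertex T i + mu j *: (vertex T j - vertex T i).
  by rewrite xE scalerBl scale1r scalerBr addrA [RHS]addrAC.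
rewrite xE => xr xd; exists (mu j); split=> //.
- by rewrite mu0 -mu1 lerDr mu0.
- by rewrite addrAC addrK.
- rewrite scalerBl scale1r [RHS]addrAC -(addrA (vertex T j)) -opprD.
  by rewrite [X in _ = X - c]addrC subrK.
Qed.

Let gram (i j : 'I_4) : i != j ->
  [/\ dot (vertex T i - c) (vertex T i - c) = r ^+ 2 + tangent_length i ^+ 2
    & dot (vertex T i - c) (vertex T j - c) = r ^+ 2 - tangent_length i * tangent_length j].
Proof.
move=> ij; have [p [/andP[p0 p1] Ei Ej xr xd]] := tangent_point ij.
move: Ei Ej xr xd; move: (vertex T j - vertex T i) => d.
move: (vertex T i + p *: d - c) => x Ei Ej xr xd.
have dx : dot d x = 0 by rewrite dotC.
have EE : dot (vertex T i - c) (vertex T i - c) = r ^+ 2 + p ^+ 2 * dot d d.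
  by rewrite Ei !(dotBl, dotBr, dotZl, dotZr) xr xd dx; ring.
have EF : dot (vertex T j - c) (vertex T j - c) = r ^+ 2 + (1 - p) ^+ 2 * dot d d.
  by rewrite Ej !(dotDl, dotDr, dotZl, dotZr) xr xd dx; ring.
have dd := dot_self_ge0 d.
have ti : tangent_length i = p * Num.sqrt (dot d d).
  rewrite /tangent_length EE addrAC subrr add0r sqrtrM ?sqr_ge0 //.
  by rewrite sqrtr_sqr ger0_norm.
have tj : tangent_length j = (1 - p) * Num.sqrt (dot d d).
  rewrite /tangent_length EF addrAC subrr add0r sqrtrM ?sqr_ge0 //.
  by rewrite sqrtr_sqr ger0_norm // subr_ge0.
split; first by rewrite ti EE exprMn sqr_sqrtr.
rewrite ti tj mulrACA -expr2 sqr_sqrtr // Ei Ej.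
by rewrite !(dotBl, dotDr, dotZl, dotZr) xr xd dx; ring.
Qed.

Let other_vertex (i : 'I_4) : exists j, i != j.
Proof.
by have [->|] := eqVneq i 0; [exists ord_max|exists 0].
Qed.

(** The tangency point cuts the edge [A_i A_j] into pieces of lengths [t_i] and
    [t_j] pointing in opposite directions, both orthogonal to the
    radius through that point: expanding [A_i - c] and [A_j - c] as this radius
    plus one of the pieces gives [r^2 - t_i t_j]. *)
Lemma tangent_gram (i j : 'I_4) : dot (vertex T i - c) (vertex T j - c) =
  r ^+ 2 - tangent_length i * tangent_length j
    + 2 * (j == i)%:R * tangent_length i ^+ 2.
Proof.
have [<-|ji] := eqVneq j i; last first.
  by rewrite mulr0 mul0r addr0; rewrite eq_sym in ji; case: (gram ji).
have [k /gram[-> _]] := other_vertex j.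
by rewrite /=; ring.
Qed.

(** If a vertex were on the sphere, all the vertices would lie in the tangent
    plane at that vertex. *)
Lemma tangent_length_gt0 i : 0 < tangent_length i.
Proof.
rewrite lt_neqAle sqrtr_ge0 andbT eq_sym; apply/negP => /eqP ti0.
have [r0 _] := hmid; have r20 : 0 < r ^+ 2 by rewrite exprn_gt0.
have E j : dot (vertex T i - c) (vertex T j - c) = r ^+ 2.
  by rewrite tangent_gram ti0; ring.
apply: (vertex_noncoplanar (t := T)).
exists (vertex T i - c), (r ^+ 2 + dot (vertex T i - c) c); split.
  by apply/eqP => ic; have := E i; rewrite ic dot0l => /esym/eqP; rewrite gt_eqF.
by move=> _ [j _ <-]; rewrite /plane /= -(E j) -dotDr subrK.
Qed.

End mid_sphere.

(** * The feet of the perpendiculars from the centre *)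

Lemma card_proper_vertices (S : {set 'I_4}) : S != [set: 'I_4]%SET -> (#|S| <= 3)%N.
Proof.
by rewrite -properT -ltnS => /proper_card; rewrite cardsT card_ord.
Qed.

Section feet.
Variables (R : realType) (T : tetrahedron R).

Definition face_point (w : {set 'I_4} -> 'I_4 -> R) (S : {set 'I_4}) : E3 R :=
  \sum_i w S i *: vertex T i.

(** A vector has equal products with all the vertices of [S] exactly when it is
    orthogonal to the face they span, so this makes the point of weights
    [face_weight t lam S] the projection of [c] onto that face. *)
Lemma face_point_foot (c : E3 R) (r : R) (lam : 'I_4 -> R) :
    let t := tangent_length T c r in let w := face_weight t lam in
    mid_sphere T c r -> \sum_i lam i = 1 -> c = \sum_i lam i *: vertex T i ->
    (forall i, 0 < t i) -> (forall i, 0 < lam i) ->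
  forall (S : {set 'I_4}) i j, i \in S -> j \in S ->
    dot (face_point w S - c) (vertex T i) = dot (face_point w S - c) (vertex T j).
Proof.
move=> t w hmid lam1 cE t_gt0 lam_gt0 S i j.
have w_out (U : {set 'I_4}) k : k \notin U -> w U k = 0 by exact: face_weight_out.
have w_sum1 (U : {set 'I_4}) : U != finset.set0 -> \sum_k w U k = 1.
  exact: sum_face_weight.
move=> iS jS; have Sn0 : S != finset.set0 by apply/set0Pn; exists i.
have [/cards1P[k Sk]|S1] := boolP (#|S| == 1%N).
  by move: iS jS; rewrite Sk !inE => /eqP-> /eqP->.
have [ST|ST] := eqVneq S [set: 'I_4]%SET.
  suff -> : face_point w S = c by rewrite subrr !dot0l.
  rewrite cE; apply: eq_bigr => k _.
  by rewrite /w /face_weight ST !inE cardsT card_ord /= eqxx.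
have S23 : (1 < #|S| <= 3)%N.
  rewrite ltn_neqAle eq_sym S1 card_gt0 Sn0 /=.
  exact: card_proper_vertices.
have [kappa H] := face_weight_balance t S23.
pose D := (#|S|.-1)%:R * \sum_(k in S) t k.
suff HS k : k \in S ->
    dot (face_point w S - c) (vertex T k - c) = r ^+ 2 - kappa / D.
  apply: (@addIr _ (- dot (face_point w S - c) c)).
  by rewrite -!dotBr !HS.
move=> kS; rewrite -(H k kS).
have -> : face_point w S - c = \sum_l w S l *: (vertex T l - c).
  under eq_bigr do rewrite scalerBr.
  by rewrite sumrB -scaler_suml w_sum1 // scale1r.
rewrite dot_suml.
under eq_bigr do rewrite (tangent_gram hmid) -/t !mulrDr.
rewrite !big_split /= -mulr_suml w_sum1 // mul1r -addrA; congr (_ + _).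
have -> : \sum_l w S l * (2 * (k == l)%:R * t l ^+ 2) = 2 * w S k * t k ^+ 2.
  rewrite (bigD1 k) //= eqxx big1 => [|l lk]; first by rewrite addr0 /=; ring.
  by rewrite eq_sym (negbTE lk) mulr0 mul0r mulr0.
have wE l : l \in S -> w S l = (\sum_(m in S) t m - t l) / D.
  by move=> lS; rewrite /w /face_weight lS /= (negbTE S1) (negbTE ST).
rewrite (bigID [in S]) /= [X in _ + X + _ = _]big1 => [|l lS]; last first.
  by rewrite w_out // mul0r.
rewrite (eq_bigr (fun l => - (t k / D) * ((\sum_(m in S) t m - t l) * t l))); last first.
  by move=> l lS; rewrite wE //; ring.
by rewrite -mulr_sumr wE //=; ring.
Qed.

End feet.

(** * The cells of the subdivision *)

Section flag_cells.
Variables (R : realType) (T : tetrahedron R) (w : {set 'I_4} -> 'I_4 -> R).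
Hypothesis w_out : forall (S : {set 'I_4}) i, i \notin S -> w S i = 0.
Hypothesis w_gt0 : forall (S : {set 'I_4}) i, i \in S -> 0 < w S i.
Hypothesis w_sum1 : forall S : {set 'I_4}, S != finset.set0 -> \sum_i w S i = 1.

Definition flag_vertex (s : {perm 'I_4}) (k : 'I_4) : E3 R :=
  face_point T w (prefix_set s k.+1).

Let w_ge0 S i : 0 <= w S i.
Proof. by have [/w_gt0/ltW//|/w_out->] := boolP (i \in S). Qed.

Let w_prefix_sum1 s (k : 'I_4) : \sum_i w (prefix_set s k.+1) i = 1.
Proof. by apply: w_sum1; apply/set0Pn; exists (s k); rewrite mem_prefix_set. Qed.

(** The cell is triangular with respect to [T]: its [k]-th vertex involves only
    the first [k + 1] vertices in the order [s], the last of them with a positive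
    weight. A plane through the cell thus contains these one after the other. *)
Lemma flag_noncoplanar s : ~ coplanar (range (flag_vertex s)).
Proof.
move=> [u [d [u0 ud]]]; apply: (vertex_noncoplanar (t := T)).
exists u, d; split=> // _ [i _ <-]; rewrite /plane /=.
rewrite -(permKV s i); move: (s^-1%g i) => {i} k.
have [m] := ubnP k; elim: m k => // m IH k; rewrite ltnS => km.
have : dot u (flag_vertex s k) = d by apply: ud; exists k.
have sk : s k \in prefix_set s k.+1 by rewrite mem_prefix_set.
rewrite dot_sumr -[in RHS](mulr1 d) -(w_prefix_sum1 s k) mulr_sumr => /eqP.
rewrite -subr_eq0 -sumrB (bigD1 (s k)) //= big1 => [|i isk]; last first.
  have [iS|iS] := boolP (i \in prefix_set s k.+1); last first.
    by rewrite w_out // mul0r mulr0 subrr.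
  suff : dot u (vertex T i) = d by move=> ->; rewrite mulrC subrr.
  rewrite -(permKV s i); apply: IH; apply: leq_trans km.
  move: iS; rewrite inE ltnS leq_eqVlt => /orP[/eqP/val_inj si|//].
  by rewrite -si permKV eqxx in isk.
by rewrite addr0 mulrC -mulrBl mulf_eq0 subr_eq0 (gt_eqF (w_gt0 sk)) orbF => /eqP.
Qed.

Definition flag_cell s : tetrahedron R := Tetrahedron (@flag_noncoplanar s).

Let flag_cell_comb s (mu : 'I_4 -> R) : \sum_k mu k *: vertex (flag_cell s) k =
  \sum_i (\sum_k mu k * w (prefix_set s k.+1) i) *: vertex T i.
Proof.
under eq_bigr do rewrite /= scaler_sumr.
rewrite exchange_big /=; apply: eq_bigr => i _; rewrite scaler_suml.
by apply: eq_bigr => k _; rewrite scalerA.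
Qed.

Let flag_cell_sum s (mu : 'I_4 -> R) :
  \sum_i \sum_k mu k * w (prefix_set s k.+1) i = \sum_k mu k.
Proof.
rewrite exchange_big /=; apply: eq_bigr => k _.
by rewrite -mulr_sumr w_prefix_sum1 mulr1.
Qed.

Lemma flag_cells_cover : \bigcup_s body (flag_cell s) = body T.
Proof.
rewrite bodyE faceE; apply/seteqP; split=> [x [s _]|x [a [a0 _ a1 ->]]].
  rewrite bodyE faceE => -[mu [mu0 _ mu1 ->]].
  exists (fun i => \sum_k mu k * w (prefix_set s k.+1) i); split.
  - by move=> i; rewrite sumr_ge0 // => k _; rewrite mulr_ge0.
  - by move=> i; rewrite inE.
  - by rewrite flag_cell_sum.
  - by rewrite flag_cell_comb.
have [s [mu [mu0 aE]]] := flag_comb_surj w_out w_gt0 a0.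
exists s => //; rewrite bodyE faceE; exists mu; split=> //.
- by move=> i; rewrite inE.
- by rewrite -(flag_cell_sum s) -a1; apply: eq_bigr => i _; rewrite aE.
- by rewrite flag_cell_comb; apply: eq_bigr => i _; rewrite aE.
Qed.

(** A set shared by two flags has the same rank in both, hence one set of
    indices describes the shared vertices in either cell. *)
Definition shared_ranks (s t : {perm 'I_4}) : {set 'I_4} :=
  [set k : 'I_4 | prefix_set s k.+1 == prefix_set t k.+1]%SET.

Lemma flag_cells_shared_face s t :
  face (flag_cell s) (shared_ranks s t) = face (flag_cell t) (shared_ranks s t).
Proof.
rewrite !faceE; apply/seteqP; split=> x [mu [mu0 muS mu1 ->]];
  exists mu; split=> //; apply: eq_bigr => k _;
  (have [|/muS->] := boolP (k \in shared_ranks s t); last by rewrite !scale0r);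
  by rewrite inE /= /flag_vertex => /eqP->.
Qed.

(** Passing to barycentric coordinates in [T], a common point has two expansions
    along flags; by uniqueness only shared sets carry weight. *)
Lemma flag_cells_inter s t :
  body (flag_cell s) `&` body (flag_cell t) = face (flag_cell s) (shared_ranks s t).
Proof.
apply/seteqP; split; last first.
  move=> x xs; split; last rewrite flag_cells_shared_face in xs;
  by move: xs; rewrite bodyE !faceE => -[mu [mu0 muS mu1 ->]]; exists mu; split=> // i;
     rewrite inE.
move=> x []; rewrite !bodyE !faceE => -[mu [mu0 _ mu1 xmu]] [nu [nu0 _ nu1 xnu]].
exists mu; split=> // k kS.
have /(flag_comb_inj w_out w_gt0 mu0 nu0)/(_ k)[_ H] : forall i,
    \sum_k mu k * w (prefix_set s k.+1) i = \sum_k nu k * w (prefix_set t k.+1) i.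
  apply: (barycentric_inj (T := T)); first by rewrite !flag_cell_sum mu1.
  by rewrite -!flag_cell_comb -xmu.
by apply: contraNeq kS => /H st; rewrite inE st.
Qed.

Lemma card_shared_ranks s t : s != t -> (1 <= #|shared_ranks s t| <= 3)%N.
Proof.
move=> st; apply/andP; split.
  by rewrite card_gt0; apply/set0Pn; exists ord_max; rewrite inE !prefix_set_full.
apply: card_proper_vertices; apply: contra st => /eqP E; apply/eqP/prefix_set_inj => k.
have : k \in shared_ranks s t by rewrite E inE.
by rewrite inE => /eqP.
Qed.

(** A point of the intersection has a zero coordinate in the first cell, since
    some vertex is not shared; interior points have none. *)
Lemma flag_cells_interior s t : s != t ->
  interior (body (flag_cell s)) `&` interior (body (flag_cell t)) = set0.
Proof.
move=> st; rewrite -subset0 => x [xs xt].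
have : (body (flag_cell s) `&` body (flag_cell t)) x.
  by split; exact: interior_subset.
rewrite flag_cells_inter faceE => -[mu [mu0 muS mu1 xE]].
rewrite xE in xs; have mup := interior_barycentric_gt0 mu1 xs.
have /card_shared_ranks/andP[_] := st.
suff -> : shared_ranks s t = [set: 'I_4]%SET by rewrite cardsT card_ord.
apply/setP => k; rewrite finset.in_setT; apply: contraT => /muS muk.
by have := mup k; rewrite muk ltxx.
Qed.

(** For [k < l] the edge from rank [k] to rank [k + 1] lies in the face spanned
    by the set of rank [l], to which both [b_l - c] and [b_(l+1) - c] are
    orthogonal, and hence so is the edge from rank [l] to rank [l + 1]. *)
Lemma flag_cell_path s c :
    (forall (S : {set 'I_4}) i j, i \in S -> j \in S ->
       dot (face_point T w S - c) (vertex T i) =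
       dot (face_point T w S - c) (vertex T j)) ->
  path_tetrahedron (flag_cell s).
Proof.
move=> orth.
have orthS (S : {set 'I_4}) (k l : 'I_4) :
    prefix_set s k.+1 \subset S -> prefix_set s l.+1 \subset S ->
    dot (face_point T w S - c) (flag_vertex s k) =
    dot (face_point T w S - c) (flag_vertex s l).
  suff H (m : 'I_4) : prefix_set s m.+1 \subset S ->
      dot (face_point T w S - c) (flag_vertex s m) =
      dot (face_point T w S - c) (vertex T (s 0)).
    by move=> /H-> /H->.
  move=> mS; rewrite dot_sumr -[RHS]mul1r -(w_prefix_sum1 s m) mulr_suml.
  apply: eq_bigr => i _; have [iS|/w_out->] := boolP (i \in prefix_set s m.+1).
    by congr (_ * _); apply: orth; apply: (fintype.subsetP mS); rewrite ?mem_prefix_set.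
  by rewrite !mul0r.
(* Consecutive ranks: the edges [(0, 1)], [(1, 2)], [(2, 3)]. *)
pose e (k : 'I_3) : 'I_4 * 'I_4 := (widen_ord (leqnSn 3) k, lift ord0 k).
have orth_lt (k l : 'I_3) : (k < l)%N ->
    dot (edge_vec (flag_cell s) (e k)) (edge_vec (flag_cell s) (e l)) = 0.
  move=> kl; rewrite /edge_vec /= dotC.
  set x := flag_vertex s (lift ord0 l); set y := flag_vertex s (widen_ord _ l).
  rewrite -(subrK c x) -addrA -[c - y]opprB dotBl !dotBr.
  rewrite (@orthS _ (lift ord0 k) (widen_ord (leqnSn 3) k)).
  - rewrite (@orthS _ (lift ord0 k) (widen_ord (leqnSn 3) k)) ?subrr //.
    + by apply: prefix_set_mono; rewrite /= /bump /= ltnS.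
    + by apply: prefix_set_mono; rewrite /= ltnW.
  - by apply: prefix_set_mono; rewrite /= /bump /= !add1n ltnS ltnW.
  - by apply: prefix_set_mono; rewrite /= /bump /= !add1n ltnS ltnW // ltnS ltnW.
exists e; split.
- by move=> k; rewrite -val_eqE /= /bump /= add1n neq_ltn leqnn.
- move=> k l; rewrite neq_ltn => /orP[/orth_lt//|lk].
  by rewrite dotC; exact: orth_lt.
(* The first and the last of the three edges are opposite, hence disjoint. *)
- rewrite -subset0 => x xe.
  have := xe ord0 I; rewrite /edge faceE => -[mu [mu0 muS mu1 xmu]].
  have := xe ord_max I; rewrite /edge faceE => -[nu [nu0 nuS nu1 xnu]].
  have munu : mu =1 nu.
    by apply: (barycentric_inj (T := flag_cell s)); rewrite ?mu1 ?nu1 // -xmu -xnu.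
  move: mu1; rewrite big1 => [/esym/eqP|k _]; first by rewrite oner_eq0.
  have [kS|/muS//] := boolP (k \in [set (e ord0).1; (e ord0).2]%SET).
  rewrite munu nuS //; move: kS; rewrite !inE -!val_eqE /= /bump /=.
  by case/orP => /eqP->.
Qed.

End flag_cells.

(** * The partition into path tetrahedra *)

Theorem theorem7 (R : realType) (T : tetrahedron R) (c : E3 R) (r : R)
    (hmid : mid_sphere T c r) (hc : interior (body T) c) :
  exists P : 'I_24 -> tetrahedron R,
    [/\ partition_into T P,
        face_to_face P
      & forall i, path_tetrahedron (P i)].
Proof.
have := interior_subset hc; rewrite bodyE faceE => -[lam [_ _ lam1 cE]].
have lam_gt0 : forall i, 0 < lam i.
  by apply: (interior_barycentric_gt0 (T := T) lam1); rewrite -cE.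
pose t := tangent_length T c r.
have t_gt0 i : 0 < t i by exact: tangent_length_gt0 hmid i.
pose w := face_weight t lam.
have w_out (S : {set 'I_4}) i : i \notin S -> w S i = 0 by exact: face_weight_out.
have w_gt0 (S : {set 'I_4}) i : i \in S -> 0 < w S i by exact: face_weight_gt0.
have w_sum1 (S : {set 'I_4}) : S != finset.set0 -> \sum_i w S i = 1.
  exact: sum_face_weight.
have orth : forall (S : {set 'I_4}) i j, i \in S -> j \in S ->
    dot (face_point T w S - c) (vertex T i) =
       dot (face_point T w S - c) (vertex T j).
  exact: face_point_foot hmid lam1 cE t_gt0 lam_gt0.
have E24 : #|{: {perm 'I_4}}| = 24 by rewrite card_Sn.
pose perm_of (i : 'I_24) : {perm 'I_4} := enum_val (cast_ord (esym E24) i).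
have perm_of_inj i j : i != j -> perm_of i != perm_of j.
  by apply: contra => /eqP/enum_val_inj/cast_ord_inj->.
exists (fun i => flag_cell T w_out w_gt0 w_sum1 (perm_of i)); split; last first.
- by move=> i; exact: flag_cell_path orth.
- move=> i j /perm_of_inj ij; right.
  exists (shared_ranks (perm_of i) (perm_of j)), (shared_ranks (perm_of i) (perm_of j)).
  split=> //; first exact: card_shared_ranks.
    exact: flag_cells_inter.
  by rewrite flag_cells_inter flag_cells_shared_face.
split=> [i j /perm_of_inj|]; first exact: flag_cells_interior.
rewrite -(flag_cells_cover T w_out w_gt0 w_sum1); apply/seteqP; split=> x.
  by move=> [i _ xi]; exists (perm_of i).
move=> [s _ xs]; exists (cast_ord E24 (enum_rank s)) => //.
by rewrite /perm_of cast_ordK enum_rankK.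
Qed.
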